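(* For every integer $n\ge0$, $spt_{2,3}(3n+2)\equiv 0\pmod 3$.
   Context: $(a;q)_\infty=\prod_{k\ge0}(1-aq^k)$ and $(a;q)_n=\prod_{k=0}^{n-1}(1-aq^k)$. The function $spt_{2,3}(n)$ is defined by $$\sum_{n\ge1}spt_{2,3}(n)q^n=\sum_{n\ge1}\frac{q^n}{(1-q^n)\,(1-q^n)(1-q^{n+1})\cdots(1-q^{2n-1})\,(q^{3n};q^3)_{\infty}};$$ combinatorially, it is the total number of appearances of the smallest part $s$, summed over all partitions of $n$ in which every part other than $s$ is either strictly between $s$ and $2s$ or a multiple of $3$ that is at least $3s$. *)

(* Defs.v *)
From HB Require Import structures.
From mathcomp Require Import all_boot all_order all_algebra.
From mathcomp Require Import boolp classical_sets.

Set Implicit Arguments.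
Unset Strict Implicit.
Unset Printing Implicit Defensive.

Import GRing.Theory.
Local Open Scope ring_scope.

(* Formal power series R[[q]]. The record keeps the Cauchy product apart from *)
(* the pointwise product carried by the bare function type nat -> R.          *)
Record fps (R : Type) := FPS { fcoef : nat -> R }.

Section FpsRing.
Variable R : comNzRingType.
Implicit Types f g h : fps R.

HB.instance Definition _ := gen_eqMixin (fps R).
HB.instance Definition _ := gen_choiceMixin (fps R).

Definition fzero : fps R := FPS (fun=> 0).
Definition fone : fps R := FPS (fun n => (n == 0%N)%:R).
Definition fadd f g : fps R := FPS (fun n => fcoef f n + fcoef g n).
Definition fopp f : fps R := FPS (fun n => - fcoef f n).
Definition fmul f g : fps R :=
  FPS (fun n => \sum_(i < n.+1) fcoef f i * fcoef g (n - i)).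

Lemma fpsP f g : (forall n, fcoef f n = fcoef g n) -> f = g.
Proof. by case: f g => [f] [g] /= /funext ->. Qed.

Definition ftrunc N f : {poly R} := \poly_(i < N) fcoef f i.

Lemma fcoef_mul_trunc N f g n : (n < N)%N ->
  fcoef (fmul f g) n = (ftrunc N f * ftrunc N g)`_n.
Proof.
move=> nN; rewrite coefM /=; apply: eq_bigr => i _.
have iN : (i < N)%N by apply: leq_trans nN; apply: ltn_ord.
by rewrite !coef_poly iN (leq_ltn_trans (leq_subr i n) nN).
Qed.

Lemma faddA : associative fadd.
Proof. by move=> f g h; apply: fpsP => n /=; rewrite addrA. Qed.
Lemma faddC : commutative fadd.
Proof. by move=> f g; apply: fpsP => n /=; rewrite addrC. Qed.
Lemma fadd0 : left_id fzero fadd.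
Proof. by move=> f; apply: fpsP => n /=; rewrite add0r. Qed.
Lemma faddN : left_inverse fzero fopp fadd.
Proof. by move=> f; apply: fpsP => n /=; rewrite addNr. Qed.

HB.instance Definition _ :=
  GRing.isZmodule.Build (fps R) faddA faddC fadd0 faddN.

Lemma fmulC : commutative fmul.
Proof.
by move=> f g; apply: fpsP => n; rewrite !(@fcoef_mul_trunc n.+1) // mulrC.
Qed.

Lemma fmulA : associative fmul.
Proof.
move=> f g h; apply: fpsP => n.
rewrite !(@fcoef_mul_trunc n.+1) //.
have E (u v w : fps R) : (ftrunc n.+1 u * ftrunc n.+1 (fmul v w))`_n =
    (ftrunc n.+1 u * (ftrunc n.+1 v * ftrunc n.+1 w))`_n.
  rewrite !coefM; apply: eq_bigr => i _; congr (_ * _).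
  have nin : (n - i < n.+1)%N by rewrite ltnS leq_subr.
  by rewrite coef_poly nin -fcoef_mul_trunc.
by rewrite E [in RHS]mulrC E mulrA mulrC.
Qed.

Lemma fmul1 : left_id fone fmul.
Proof.
move=> f; apply: fpsP => n /=; rewrite big_ord_recl /= mul1r subn0.
by rewrite big1 ?addr0 // => i _; rewrite mul0r.
Qed.

Lemma fmulDl : left_distributive fmul fadd.
Proof.
move=> f g h; apply: fpsP => n /=; rewrite -big_split /=.
by apply: eq_bigr => i _; rewrite mulrDl.
Qed.

Lemma fone_neq0 : fone != 0.
Proof.
apply/eqP => /(congr1 (fun f => fcoef f 0)) /= /eqP.
by rewrite oner_eq0.
Qed.

HB.instance Definition _ := GRing.Zmodule_isComNzRing.Build (fps R)
  fmulA fmulC fmul1 fmulDl fone_neq0.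

Definition funit : {pred fps R} := fun f => `[< exists g, g * f = 1 >].
Definition finv f : fps R :=
  if f \in funit then xget 0 [set g | g * f = 1]%classic else f.

Lemma fmulV : {in funit, left_inverse 1 finv *%R}.
Proof.
move=> f fU; rewrite /finv fU.
by by have /asboolP ex := fU; apply: (xgetPex 0 ex).
Qed.

Lemma funitPl f g : g * f = 1 -> funit f.
Proof. by move=> gf; apply/asboolP; exists g. Qed.

Lemma finv_out : {in [predC funit], finv =1 id}.
Proof. by move=> f; rewrite inE /= /finv => /negbTE ->. Qed.

HB.instance Definition _ :=
  GRing.ComNzRing_hasMulInverse.Build (fps R) fmulV funitPl finv_out.

Definition fpsX : fps R := FPS (fun n => (n == 1%N)%:R).

(* Limit for the q-adic topology: every coefficient is eventually constant.   *)
(* Junk value 0 for sequences that do not converge.                           *)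
Definition fcvg (u : nat -> fps R) (l : fps R) : Prop :=
  forall m, exists N0, forall N, (N0 <= N)%N -> fcoef (u N) m = fcoef l m.

Definition flim (u : nat -> fps R) : fps R := xget 0 (fcvg u).

Definition qpoch (a q : fps R) (n : nat) : fps R :=
  \prod_(0 <= k < n) (1 - a * q ^+ k).

Definition qpochoo (a q : fps R) : fps R := flim (qpoch a q).

(* \sum_(n >= 1) u n *)
Definition fseries1 (u : nat -> fps R) : fps R :=
  flim (fun N => \sum_(1 <= n < N.+1) u n).

Lemma fcvg_unique u l l' : fcvg u l -> fcvg u l' -> l = l'.
Proof.
move=> ul ul'; apply: fpsP => m.
have [N1 H1] := ul m; have [N2 H2] := ul' m.
by rewrite -(H1 (maxn N1 N2)) ?leq_maxl // H2 ?leq_maxr.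
Qed.

Lemma fcvg_lim u l : fcvg u l -> flim u = l.
Proof.
by move=> ul; apply: xget_unique => // l' ul'; apply: fcvg_unique ul' ul.
Qed.

Definition fvanish n f : Prop := forall i, (i < n)%N -> fcoef f i = 0.

Lemma fvanishM m n f g : fvanish m f -> fvanish n g -> fvanish (m + n) (f * g).
Proof.
move=> fm gn i imn; apply: big1 => -[j ji] _ /=.
have [jm|mj] := ltnP j m; first by rewrite fm ?mul0r.
rewrite gn ?mulr0 // -(ltn_add2l j) subnKC //.
by apply: leq_trans imn _; rewrite leq_add2r.
Qed.

Lemma fvanishMl n f g : fvanish n f -> fvanish n (f * g).
Proof. by move=> fn; rewrite -[n]addn0; apply: fvanishM. Qed.

Lemma fvanishX n f : fvanish 1 f -> fvanish n (f ^+ n).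
Proof.
by move=> f1; elim: n => [//|n IH]; rewrite exprS -add1n; apply: fvanishM.
Qed.

Lemma fvanishW m n f : (m <= n)%N -> fvanish n f -> fvanish m f.
Proof. by move=> mn fn i im; apply: fn; apply: leq_trans mn. Qed.

Lemma fcoefD f g n : fcoef (f + g) n = fcoef f n + fcoef g n.
Proof. by []. Qed.

Lemma fcoefN f n : fcoef (- f) n = - fcoef f n.
Proof. by []. Qed.

(* A sequence whose n-th increment is O(q^n) converges. *)
Lemma fcvg_incr (u : nat -> fps R) :
  (forall n, fvanish n (u n.+1 - u n)) -> exists l, fcvg u l.
Proof.
move=> du; exists (FPS (fun m => fcoef (u m.+1) m)) => m; exists m.+1 => N.
elim: N => [//|N IH]; rewrite leq_eqVlt => /predU1P[<-//|]; rewrite ltnS => mN.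
rewrite -(IH mN); apply/eqP; rewrite -subr_eq0 -fcoefN -fcoefD.
by rewrite (du N).
Qed.

Lemma fps_unit1B h : fvanish 1 h -> (1 - h) \is a GRing.unit.
Proof.
move=> h1; pose s n := \sum_(i < n) h ^+ i.
have [l sl] : exists l, fcvg s l.
  apply: fcvg_incr => n; rewrite /s big_ord_recr /= addrC addrK.
  exact: fvanishX.
suff /funitPl : l * (1 - h) = 1 by [].
apply: fpsP => n.
have [N HN] : exists N, forall i, (i <= n)%N -> fcoef (s N) i = fcoef l i.
  suff [N HN] : exists N0, forall N, (N0 <= N)%N ->
      forall i, (i <= n)%N -> fcoef (s N) i = fcoef l i.
    by exists N; apply: HN.
  elim: n => [|n [N1 H1]].
    have [N H] := sl 0%N; exists N => M /H e i.
    by rewrite leqn0 => /eqP ->.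
  have [N2 H2] := sl n.+1; exists (maxn N1 N2) => M.
  rewrite geq_max => /andP[M1 M2] i.
  by rewrite leq_eqVlt => /predU1P[->|]; [apply: H2|rewrite ltnS; apply: H1].
have [K [KN HK]] : exists K, (n < K)%N /\
    forall i, (i <= n)%N -> fcoef (s K) i = fcoef l i.
  exists (maxn n.+1 N); split; first exact: leq_maxl.
  move=> i iN; rewrite -HN //.
  suff H M : fcoef (s (maxn (n.+1) M)) i = fcoef l i by rewrite H HN.
  have [N0 H0] := sl i.
  suff H (a b : nat) : (i < a)%N -> fcoef (s (a + b)%N) i = fcoef (s a) i.
    rewrite -(H0 (maxn n.+1 M + N0)%N) ?leq_addl // H //.
    by rewrite leq_max ltnS iN.
  move=> ia; elim: b => [|b IH]; first by rewrite addn0.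
  rewrite addnS /s big_ord_recr /= -/(s _) IH.
  by rewrite (@fvanishX (a + b) _ h1) ?addr0 // (leq_trans ia) // leq_addr.
transitivity (fcoef (s K * (1 - h)) n).
  by apply: eq_bigr => i _; rewrite HK // -ltnS.
have -> : s K * (1 - h) = 1 - h ^+ K.
  by rewrite mulrC /s -{2}(expr1n (fps R) K) subrXX; congr (_ * _);
     apply: eq_bigr => i _; rewrite expr1n mul1r.
by rewrite fcoefD fcoefN (@fvanishX K _ h1) // subr0.
Qed.

Lemma qpoch_cvg (a q : fps R) :
  fvanish 1 q -> fcvg (qpoch a q) (qpochoo a q).
Proof.
move=> q1; have [n|l ul] := @fcvg_incr (qpoch a q); last first.
  by rewrite /qpochoo (fcvg_lim ul).
rewrite /qpoch big_nat_recr //= mulrBr mulr1 addrAC subrr add0r.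
by rewrite mulrA mulrC -mulrN; apply/fvanishMl/fvanishX.
Qed.

Lemma fseries1_cvg (u : nat -> fps R) : (forall n, fvanish n (u n)) ->
  fcvg (fun N => \sum_(1 <= n < N.+1) u n) (fseries1 u).
Proof.
move=> un; set s := (X in fcvg X).
have [n|l ul] := @fcvg_incr s; last by rewrite /fseries1 (fcvg_lim ul).
rewrite /s big_nat_recr //= addrC addrK.
by apply: fvanishW (un n.+1).
Qed.

End FpsRing.

Arguments fpsX {R}.

Definition spt23_term (n : nat) : fps int :=
  let q := fpsX in
  q ^+ n / ((1 - q ^+ n) * qpoch (q ^+ n) q n * qpochoo (q ^+ (3 * n)) (q ^+ 3)).

Definition spt23 (n : nat) : int := fcoef (fseries1 spt23_term) n.

Lemma fvanish_fpsX (n : nat) : fvanish n ((fpsX : fps int) ^+ n).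
Proof. by apply: fvanishX => -[]. Qed.

Lemma spt23_cvg :
  fcvg (fun N => \sum_(1 <= n < N.+1) spt23_term n) (fseries1 spt23_term).
Proof.
by apply: fseries1_cvg => n; apply: fvanishMl; apply: fvanish_fpsX.
Qed.

Lemma spt23_den_unit (n : nat) (q := fpsX : fps int) : (0 < n)%N ->
  (1 - q ^+ n) * qpoch (q ^+ n) q n * qpochoo (q ^+ (3 * n)) (q ^+ 3)
    \is a GRing.unit.
Proof.
move=> n0.
have qv k : (0 < k)%N -> fvanish 1 (q ^+ k).
  by move=> k0; apply: fvanishW (@fvanish_fpsX k).
rewrite !unitrM -andbA; apply/and3P; split.
- exact/fps_unit1B/qv.
- apply: rpred_prod => k _; apply: fps_unit1B.
  by apply: fvanishMl; apply: qv.
- set p := qpochoo _ _.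
  have [|N HN] := @qpoch_cvg _ (q ^+ (3 * n)) (q ^+ 3) _ 0%N; first exact: qv.
  suff /fps_unit1B : fvanish 1 (1 - p) by rewrite subKr.
  case=> // _; rewrite fcoefD fcoefN -(HN N) // /qpoch.
  have H m : fvanish 1 (1 - \prod_(0 <= k < m)
      (1 - q ^+ (3 * n) * (q ^+ 3) ^+ k)).
    elim: m => [|m IH]; first by rewrite big_geq // subrr.
    rewrite big_nat_recr //= mulrBr mulr1 opprB addrCA => i i1.
    rewrite fcoefD IH // addr0 mulrCA.
    by apply: (@fvanishMl _ 1) i1; apply: qv; rewrite muln_gt0.
  exact: H.
Qed.

(* Main.v *)
Require Import Defs.
From mathcomp Require Import all_boot all_order all_algebra.
From mathcomp Require Import ring zify.

(** Multiplied by [(q^3; q^3)_oo], the [n]-th summand of the series becomes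
    [q^n (q; q)_(n-1)^2 beta_n], where [beta_n = (q^3; q^3)_(n-1) / ((q; q)_n (q; q)_(2n-1))]
    belongs to Slater's Bailey pair J(1): it is a combination of the quotients
    [1 / ((q; q)_(n-j) (q; q)_(n+j))] with [3 | j]. This is the part of the finite
    Jacobi triple product carried by the exponents of [z] divisible by 3. For fixed
    [j > 0] the sum over [n] telescopes to [q^j / (1 - q^j)^2], a series in [q^3], and
    [j = 0] leaves [\sum q^n / (1 - q^n)^2 = \sum sigma(m) q^m]. Since
    [3 | sigma(3k + 2)] and [(q^3; q^3)_oo] is itself a series in [q^3] with constant
    term 1, the congruence follows. *)

Set Implicit Arguments.
Unset Strict Implicit.
Unset Printing Implicit Defensive.

Import GRing.Theory.
Local Open Scope ring_scope.

Local Notation q := (fpsX : fps int).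
Local Notation P := (qpoch q q).

(** * Finite q-Pochhammer products and their inverses *)

Lemma qpoch0 (a x : fps int) : qpoch a x 0 = 1.
Proof. by rewrite /qpoch big_geq. Qed.

Lemma qpochS (a x : fps int) n : qpoch a x n.+1 = qpoch a x n * (1 - a * x ^+ n).
Proof. by rewrite /qpoch big_nat_recr. Qed.

Lemma qpochD (a x : fps int) m n :
  qpoch a x (m + n) = qpoch a x m * qpoch (a * x ^+ m) x n.
Proof.
elim: n => [|n IH]; first by rewrite addn0 qpoch0 mulr1.
by rewrite addnS !qpochS IH -!mulrA -exprD.
Qed.

Lemma eulerS n : P n.+1 = P n * (1 - q ^+ n.+1).
Proof. by rewrite qpochS -exprS. Qed.

Lemma fpsX_vanish1 n : (0 < n)%N -> fvanish 1 (q ^+ n).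
Proof. by move=> n0; apply: fvanishW (@fvanish_fpsX n). Qed.

Lemma unit_1BXn n : (0 < n)%N -> 1 - q ^+ n \is a GRing.unit.
Proof. by move=> n0; apply/fps_unit1B/fpsX_vanish1. Qed.

Lemma unit_euler n : P n \is a GRing.unit.
Proof.
elim: n => [|n IH]; first by rewrite qpoch0 unitr1.
by rewrite eulerS unitrM IH unit_1BXn.
Qed.

Lemma eulerVS n : (P n)^-1 = (P n.+1)^-1 * (1 - q ^+ n.+1).
Proof.
apply: (mulrI (unit_euler n)); rewrite mulrV ?unit_euler // mulrCA -eulerS.
by rewrite mulVr ?unit_euler.
Qed.

(** * Recurrences for the finite Jacobi triple product *)

(* The coefficient of [z ^ j] in the finite triple product                    *)
(* [(z; q)_n (q / z; q)_n] is [jtp n j], and that of [z ^ - j] is             *)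
(* [q ^+ j * jtp n j].                                                        *)
Definition jtp_sign j : fps int := (-1) ^+ j * q ^+ 'C(j, 2).

Definition bailey n j : fps int :=
  if (j <= n)%N then (P (n - j))^-1 * (P (n + j))^-1 else 0.

Definition jtp n j := jtp_sign j * P n.*2 * bailey n j.

Lemma jtp_signS j : jtp_sign j.+1 = - q ^+ j * jtp_sign j.
Proof. by rewrite /jtp_sign binS bin1 !exprD exprS; ring. Qed.

Lemma bailey_ge n j d k : n = (j + d)%N -> k = (n + j)%N ->
  bailey n j = (P d)^-1 * (P k)^-1.
Proof. by move=> -> ->; rewrite /bailey leq_addr addKn. Qed.

Lemma bailey_lt n j : (n < j)%N -> bailey n j = 0.
Proof. by rewrite /bailey ltnNge => /negbTE ->. Qed.

Lemma euler_double n : P n.+1.*2 = P n.*2 * (1 - q ^+ n.*2.+1) * (1 - q ^+ n.*2.+2).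
Proof. by rewrite doubleS !eulerS. Qed.

(** Passing to [n.+1] multiplies by (1 - z q^n)(1 - q^(n+1)/z) = 1 + q^(2n+1) - z q^n - q^(n+1)/z.
    The coefficient of 1/z is [q * jtp n 1], so both neighbours of z^0 contribute equally. *)
Lemma jtpS0 n : jtp n.+1 0 =
  (1 + q ^+ n.*2.+1) * jtp n 0 - 2 * q ^+ n.+1 * jtp n 1.
Proof.
rewrite /jtp jtp_signS euler_double (@bailey_ge n.+1 0 n.+1 n.+1) ?addn0 //.
rewrite (@bailey_ge n 0 n n) ?addn0 // expr0.
case: n => [|d].
  by rewrite bailey_lt // double0 (eulerVS 0); ring.
rewrite (@bailey_ge d.+1 1 d d.+2) ?addn1 //.
rewrite (eulerVS d) (eulerVS d.+1) -addnn !exprS !exprD !exprS; ring.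
Qed.

Lemma jtpSS n j : jtp n.+1 j.+1 =
  (1 + q ^+ n.*2.+1) * jtp n j.+1 - q ^+ n * jtp n j - q ^+ n.+1 * jtp n j.+2.
Proof.
rewrite /jtp !jtp_signS euler_double.
have [nj|] := ltnP n j.
  by rewrite !bailey_lt ?mulr0 ?subr0 //; lia.
move=> /subnKC <-; move: (n - j)%N => {n} d.
rewrite (@bailey_ge (j + d).+1 j.+1 d (d + j + j).+2) ?(@bailey_ge (j + d) j d (d + j + j)); try lia.
rewrite (eulerVS (d + j + j)) (eulerVS (d + j + j).+1).
(* For d = 0 and then d = 1, some neighbours lie beyond [n], where [bailey] is 0 by convention. *)
case: d => [|d].
  rewrite !bailey_lt ?ltnS ?addn0 ?add0n // -addnn !exprS !exprD; ring.
rewrite (@bailey_ge (j + d.+1) j.+1 d (d.+1 + j + j).+1); try lia.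
rewrite (eulerVS (d.+1 + j + j).+1).
case: d => [|d].
  by rewrite bailey_lt ?addn1 // (eulerVS 0) -!addnn !exprS !exprD !exprS; ring.
rewrite (@bailey_ge (j + d.+2) j.+2 d (d.+2 + j + j).+2); try lia.
rewrite (eulerVS d) (eulerVS d.+1) -!addnn !exprS !exprD !exprS; ring.
Qed.

Lemma jtp_gt n j : (n < j)%N -> jtp n j = 0.
Proof. by move=> nj; rewrite /jtp bailey_lt // mulr0. Qed.

Lemma jtp00 : jtp 0 0 = 1.
Proof.
by rewrite /jtp /jtp_sign (@bailey_ge 0 0 0 0) // double0 qpoch0 invr1 !expr0 !mulr1.
Qed.

(** * Trisection by the exponent of z modulo 3 *)

(* The parts of [(z; q)_n (q / z; q)_n] with exponents of [z] congruent to    *)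
(* 0, 1 and 2 modulo 3, evaluated at [z = 1].                                 *)
Definition trisect0 n R :=
  jtp n 0 + \sum_(r < R) (1 + q ^+ (3 * r).+3) * jtp n (3 * r).+3.
Definition trisect1 n R :=
  \sum_(r < R) (jtp n (3 * r).+1 + q ^+ (3 * r).+2 * jtp n (3 * r).+2).
Definition trisect2 n R :=
  \sum_(r < R) (jtp n (3 * r).+2 + q ^+ (3 * r).+1 * jtp n (3 * r).+1).

(** Multiplying by z or 1/z permutes the residue classes. The last term comes from the cut at [R]
    and is 0 once 3R > n. *)
Lemma trisect0S n R : trisect0 n.+1 R =
  (1 + q ^+ n.*2.+1) * trisect0 n R - q ^+ n * trisect2 n R
  - q ^+ n.+1 * trisect1 n R - q ^+ n.+1 * (1 + q ^+ (3 * R)) * jtp n (3 * R).+1.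
Proof.
rewrite /trisect0 /trisect1 /trisect2; elim: R => [|R IH].
  by rewrite !big_ord0 muln0 jtpS0 expr0; ring.
rewrite !big_ord_recr /= addrA IH mulnS -[(3 + 3 * R)%N]/(3 * R).+3 jtpSS !exprS.
ring.
Qed.

Lemma trisect1S n R : trisect1 n.+1 R =
  (1 + q ^+ n.*2.+1) * trisect1 n R - q ^+ n * trisect0 n R
  - q ^+ n.+1 * trisect2 n R + q ^+ n * jtp n (3 * R).
Proof.
rewrite /trisect0 /trisect1 /trisect2; elim: R => [|R IH].
  by rewrite !big_ord0 muln0; ring.
rewrite !big_ord_recr /= IH mulnS -[(3 + 3 * R)%N]/(3 * R).+3 !jtpSS !exprS.
ring.
Qed.

Lemma trisect2S n R : trisect2 n.+1 R =
  (1 + q ^+ n.*2.+1) * trisect2 n R - q ^+ n * trisect1 n R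
  - q ^+ n.+1 * trisect0 n R + q ^+ n.+1 * q ^+ (3 * R) * jtp n (3 * R).
Proof.
rewrite /trisect0 /trisect1 /trisect2; elim: R => [|R IH].
  by rewrite !big_ord0 muln0; ring.
rewrite !big_ord_recr /= IH mulnS -[(3 + 3 * R)%N]/(3 * R).+3 !jtpSS !exprS.
ring.
Qed.

(** This is (wq; q)_n (q/w; q)_n for a primitive cube root of unity w, kept over the integers. *)
Definition cubic n : fps int := \prod_(0 <= k < n) (1 + q ^+ k.+1 + q ^+ k.+1 ^+ 2).

Lemma qpoch3_euler n : qpoch (q ^+ 3) (q ^+ 3) n = P n * cubic n.
Proof.
elim: n => [|n IH]; first by rewrite /cubic big_geq // !qpoch0 mulr1.
rewrite qpochS IH eulerS /cubic big_nat_recr //= -exprS -exprM mulnC exprM; ring.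
Qed.

(** The triple product at [n.+1] is 0 at z = 1 and (1 - w)(1 - w^2 q^(n+1)) [cubic n] at each
    primitive cube root w; these values determine the three parts. The induction on the recurrences
    avoids adjoining w. *)
Lemma trisectE n R : (n < R)%N ->
  [/\ trisect0 n.+1 R = (1 + q ^+ n.+1) * cubic n, trisect1 n.+1 R = - cubic n
    & trisect2 n.+1 R = - (q ^+ n.+1 * cubic n)].
Proof.
elim: n => [|n IH] nR.
  rewrite trisect0S trisect1S trisect2S.
  have j1 : jtp 0 (3 * R) = 0 by rewrite jtp_gt //; lia.
  have j2 : jtp 0 (3 * R).+1 = 0 by rewrite jtp_gt.
  have -> : trisect0 0 R = 1.
    by rewrite /trisect0 big1 ?addr0 ?jtp00 // => i _; rewrite jtp_gt ?mulr0.
  have -> : trisect1 0 R = 0.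
    by rewrite /trisect1 big1 // => i _; rewrite !jtp_gt // mulr0 addr0.
  have -> : trisect2 0 R = 0.
    by rewrite /trisect2 big1 // => i _; rewrite !jtp_gt // mulr0 addr0.
  by rewrite j1 j2 /cubic big_geq // expr0; split; ring.
rewrite (trisect0S n.+1) (trisect1S n.+1) (trisect2S n.+1).
have [|-> -> ->] := IH; first by lia.
rewrite !jtp_gt; try lia.
rewrite [cubic n.+1]big_nat_recr //= -/(cubic n) -addnn !exprS !exprD !exprS.
by split; ring.
Qed.

(* Slater's Bailey pair J(1), at [n.+1]. *)
Lemma cubic_bailey n N : (n < N)%N ->
  (1 + q ^+ n.+1) * cubic n * (P n.+1.*2)^-1 =
  bailey n.+1 0 +
    \sum_(r < N) (1 + q ^+ (3 * r).+3) * jtp_sign (3 * r).+3 * bailey n.+1 (3 * r).+3.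
Proof.
move=> nN; have [<- _ _] := trisectE nN.
have jV j : jtp n.+1 j * (P n.+1.*2)^-1 = jtp_sign j * bailey n.+1 j.
  by rewrite /jtp mulrAC mulrK ?unit_euler.
rewrite /trisect0 mulrDl jV mulr_suml /jtp_sign !expr0 !mul1r.
by congr (_ + _); apply: eq_bigr => r _; rewrite -mulrA jV mulrA.
Qed.

(* Telescopes because [(1 - q^n)^2 - (1 - q^(n-j)) (1 - q^(n+j)) = q^(n-j) (1 - q^j)^2]. *)
Lemma bailey_sum j N : (0 < j)%N ->
  (1 - q ^+ j) ^+ 2 * \sum_(n < N) q ^+ n.+1 * P n ^+ 2 * bailey n.+1 j =
  q ^+ j * P N ^+ 2 * bailey N j.
Proof.
move=> j0; elim: N => [|N IH]; first by rewrite big_ord0 bailey_lt // !mulr0.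
rewrite big_ord_recr /= mulrDr IH; clear IH.
have [Nj|] := leqP j N.
  rewrite -(subnKC Nj); move: (N - j)%N => d.
  rewrite (@bailey_ge (j + d) j d (d + j + j)) ?(@bailey_ge (j + d).+1 j d.+1 (d + j + j).+1); try lia.
  rewrite (eulerVS d) (eulerVS (d + j + j)) (eulerS (j + d)) !exprS !exprD; ring.
move=> Nj; rewrite [bailey N j]bailey_lt // mulr0 add0r.
have [<-|Nj'] := eqVneq N.+1 j; last by rewrite bailey_lt ?mulr0 //; lia.
rewrite eulerS; ring.
Qed.

(** * Infinite products and the summands of the series *)

Lemma fcvgMr (u : nat -> fps int) l g :
  fcvg u l -> fcvg (fun N => u N * g) (l * g).
Proof.
move=> ul m.
(* Coefficient m of a product involves all coefficients up to m, so one bound must serve them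
   all. *)
have [N0 H] : exists N0, forall N, (N0 <= N)%N ->
    forall i, (i <= m)%N -> fcoef (u N) i = fcoef l i.
  elim: m => [|m [N1 H1]].
    by have [N0 H] := ul 0%N; exists N0 => N /H e i; rewrite leqn0 => /eqP ->.
  have [N2 H2] := ul m.+1; exists (maxn N1 N2) => N.
  rewrite geq_max => /andP[/H1 N1N /H2 N2N] i.
  by rewrite leq_eqVlt => /predU1P[->|]; [|rewrite ltnS; apply: N1N].
exists N0 => N /H e; apply: eq_bigr => i _.
by rewrite e // -ltnS.
Qed.

Lemma qpochooD (a x : fps int) m : fvanish 1 x ->
  qpochoo a x = qpoch a x m * qpochoo (a * x ^+ m) x.
Proof.
move=> x1; apply: (@fcvg_unique _ (fun n => qpoch a x (m + n))).
  move=> k; have [N0 H] := @qpoch_cvg _ a x x1 k.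
  by exists N0 => N N0N; apply/H/(leq_trans N0N)/leq_addl.
rewrite mulrC => k.
have [N0 H] := @fcvgMr _ _ (qpoch a x m) (@qpoch_cvg _ (a * x ^+ m) x x1) k.
by exists N0 => N N0N; rewrite qpochD [qpoch _ _ _ * _]mulrC; apply: H.
Qed.

(** The tail of (q^3; q^3)_oo cancels the infinite product in the denominator. Completing the rest
    to (q; q)_(2n+2) brings in 1 - q^(2n+2), hence the factor 1 + q^(n+1). *)
Lemma spt23_termE n :
  spt23_term n.+1 * qpochoo (q ^+ 3) (q ^+ 3) =
  q ^+ n.+1 * P n ^+ 2 * ((1 + q ^+ n.+1) * cubic n * (P n.+1.*2)^-1).
Proof.
rewrite (@qpochooD _ _ n); last exact: fpsX_vanish1.
rewrite qpoch3_euler -exprS -exprM /spt23_term.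
have := spt23_den_unit (ltn0Sn n); have := unit_euler n.+1.*2.
have -> : P n.+1.*2 =
    P n * qpoch (q ^+ n.+1) q n.+1 * ((1 - q ^+ n.+1) * (1 + q ^+ n.+1)).
  rewrite doubleS eulerS.
  have -> : q ^+ n.*2.+2 = (q ^+ n.+1) ^+ 2 by rewrite -exprM muln2.
  by rewrite -addnn -addnS qpochD -exprS; ring.
set x := q ^+ n.+1; set A := qpoch x q n.+1; set Z := qpochoo _ _.
set V := P n * A * ((1 - x) * _); set U := (1 - x) * A * Z => uV uU.
(* Clear both denominators, [U] and [V]. *)
apply: (mulIr uU); apply: (mulIr uV).
transitivity (x * (P n * cubic n * Z) * V * (U^-1 * U)).
  by move: U^-1 => Ui; ring.
transitivity (x * P n ^+ 2 * ((1 + x) * cubic n) * U * (V^-1 * V)).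
  by rewrite !mulVr // /U /V; ring.
by move: V^-1 => Vi; ring.
Qed.

(** * Coefficients and q-adic estimates *)

Lemma fcoefXM (f : fps int) n m :
  fcoef (f * q ^+ n) m = if (n <= m)%N then fcoef f (m - n) else 0.
Proof.
have fqS (g : fps int) k : fcoef (g * q) k.+1 = fcoef g k.
  rewrite mulrC /= !big_ord_recl /= mul0r add0r mul1r subSS subn0 big1 ?addr0 //.
  by move=> i _; rewrite mul0r.
have fq0 (g : fps int) : fcoef (g * q) 0 = 0.
  by rewrite mulrC /= big_ord_recl big_ord0 mul0r addr0.
elim: n m => [|n IH] m; first by rewrite expr0 mulr1 subn0.
by rewrite exprSr mulrA; case: m => [|m]; rewrite ?fq0 // fqS IH ltnS subSS.
Qed.

Lemma fcoefXn n m : fcoef (q ^+ n) m = (m == n)%:R.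
Proof.
rewrite -[q ^+ n]mul1r fcoefXM /=; case: leqP => [nm|mn]; last by rewrite ltn_eqF.
by rewrite subn_eq0 eqn_leq nm andbT.
Qed.

Lemma fvanishD n (f g : fps int) : fvanish n f -> fvanish n g -> fvanish n (f + g).
Proof. by move=> fn gn i ni; rewrite fcoefD fn // gn // addr0. Qed.

Lemma fvanishN n (f : fps int) : fvanish n f -> fvanish n (- f).
Proof. by move=> fn i ni; rewrite fcoefN fn // oppr0. Qed.

Lemma fvanishMr n (f g : fps int) : fvanish n g -> fvanish n (f * g).
Proof. by rewrite mulrC; apply: fvanishMl. Qed.

Lemma euler_vanish n d : fvanish n.+1 (P (n + d) - P n).
Proof.
elim: d => [|d IH]; first by rewrite addn0 subrr.
have -> : P (n + d.+1) - P n = (P (n + d) - P n) - P (n + d) * q ^+ (n + d).+1.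
  by rewrite addnS eulerS; ring.
apply: fvanishD => //; apply/fvanishN/fvanishMr.
by apply: fvanishW (@fvanish_fpsX _); rewrite ltnS leq_addr.
Qed.

(** The quotient P N / P (N - j) is 1 only up to O(q^(N-j+1)); the factor q^j makes up for the
    loss. *)
Lemma bailey_vanish N j :
  fvanish N.+1 (q ^+ j * P N ^+ 2 * bailey N j - q ^+ j).
Proof.
have [jN|Nj] := leqP j N; last first.
  rewrite bailey_lt // mulr0 add0r.
  by apply/fvanishN/(fvanishW Nj)/fvanish_fpsX.
rewrite (@bailey_ge N j (N - j) (N + j)) ?subnKC //.
set X := P N / P (N - j); set Y := P N / P (N + j).
have -> : q ^+ j * P N ^+ 2 * ((P (N - j))^-1 * (P (N + j))^-1) - q ^+ j =
    q ^+ j * ((X - 1) * Y + (Y - 1)) by rewrite /X /Y; ring.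
have -> : N.+1 = (j + (N - j).+1)%N by lia.
apply: fvanishM; first exact: fvanish_fpsX.
apply: fvanishD.
  apply: fvanishMl; have -> : X - 1 = (P N - P (N - j)) * (P (N - j))^-1.
    by rewrite mulrBl mulrV ?unit_euler.
  by apply: fvanishMl; have := @euler_vanish (N - j) j; rewrite subnK.
have -> : Y - 1 = - ((P (N + j) - P N) * (P (N + j))^-1).
  by rewrite mulrBl mulrV ?unit_euler // opprB.
apply/fvanishN/fvanishMl; apply: fvanishW (@euler_vanish _ _).
by rewrite ltnS leq_subr.
Qed.

(** * Series in q^3 and divisibility in degrees 2 modulo 3 *)

Definition series_in_q3 (f : fps int) := forall m, ~~ (3 %| m)%N -> fcoef f m = 0.

(** The bound [N] accommodates truncated sums, which match their limits only in low degrees. *)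
Definition dvd3_upto N (f : fps int) :=
  forall m, (m < N)%N -> (m %% 3 = 2)%N -> (3 %| fcoef f m)%Z.

Lemma series_in_q3_1 : series_in_q3 1.
Proof. by case. Qed.

Lemma series_in_q3N f : series_in_q3 f -> series_in_q3 (- f).
Proof. by move=> fP m m3; rewrite fcoefN fP ?oppr0. Qed.

Lemma series_in_q3D f g : series_in_q3 f -> series_in_q3 g -> series_in_q3 (f + g).
Proof. by move=> fP gP m m3; rewrite fcoefD fP ?gP ?addr0. Qed.

Lemma series_in_q3M f g : series_in_q3 f -> series_in_q3 g -> series_in_q3 (f * g).
Proof.
move=> fP gP m m3; apply: big1 => -[i /= im] _.
have [i3|i3] := boolP (3 %| i)%N; last by rewrite fP ?mul0r.
by rewrite gP ?mulr0 // dvdn_subl.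
Qed.

Lemma series_in_q3X f n : series_in_q3 f -> series_in_q3 (f ^+ n).
Proof.
move=> fP; elim: n => [|n IH]; first exact: series_in_q3_1.
by rewrite exprS; apply: series_in_q3M.
Qed.

Lemma series_in_q3_Xn n : (3 %| n)%N -> series_in_q3 (q ^+ n).
Proof. by move=> n3 m m3; rewrite fcoefXn; case: eqP => // e; rewrite e n3 in m3. Qed.

Lemma dvd3_upto_q3 N f : series_in_q3 f -> dvd3_upto N f.
Proof. by move=> fP m _ m2; rewrite fP ?dvdz0 // /dvdn m2. Qed.

Lemma dvd3_uptoD N f g : dvd3_upto N f -> dvd3_upto N g -> dvd3_upto N (f + g).
Proof. by move=> fP gP m mN m2; rewrite fcoefD rpredD ?fP ?gP. Qed.

Lemma dvd3_upto_vanish N f g : fvanish N (f - g) -> dvd3_upto N g -> dvd3_upto N f.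
Proof.
move=> fg gP m mN m2; rewrite -[f](subrK g) fcoefD fg // add0r; exact: gP.
Qed.

(** In degree m, the terms of [f * u] other than [fcoef f m] involve only degrees i < m of [f] with
    i = m modulo 3, so strong induction applies. *)
Lemma dvd3_upto_cancel N f u : series_in_q3 u -> fcoef u 0 = 1 ->
  dvd3_upto N (f * u) -> dvd3_upto N f.
Proof.
move=> uP u0 fuP m; elim/ltn_ind: m => m IH mN m2.
have := fuP m mN m2; rewrite /= big_ord_recr /= subnn u0 mulr1 rpredDl //.
apply: rpred_sum => -[i /= im] _.
have [i3|i3] := boolP (3 %| m - i)%N; last by rewrite uP // mulr0 dvdz0.
apply: dvdz_mulr; apply: IH => //; first exact: ltn_trans mN.
by move: i3 m2 im; lia.
Qed.

Lemma fcoef0M (f g : fps int) : fcoef (f * g) 0 = fcoef f 0 * fcoef g 0.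
Proof. by rewrite /= big_ord_recl big_ord0 addr0. Qed.

Lemma fcoef0_1BXn n : (0 < n)%N -> fcoef (1 - q ^+ n) 0 = 1.
Proof. by case: n => // n _; rewrite fcoefD fcoefN fcoefXn. Qed.

Lemma qpochoo3_in_q3 : series_in_q3 (qpochoo (q ^+ 3) (q ^+ 3)).
Proof.
move=> m m3; have [N0 H] := @qpoch_cvg _ (q ^+ 3) _ (fpsX_vanish1 (isT : 0 < 3)%N) m.
rewrite -(H N0) // {H}.
move: N0 m m3; elim=> [|n IH]; first by rewrite qpoch0; apply: series_in_q3_1.
rewrite qpochS; apply: series_in_q3M => //.
apply: series_in_q3D; first exact: series_in_q3_1.
by apply: series_in_q3N; rewrite -exprS -exprM; apply: series_in_q3_Xn; apply: dvdn_mulr.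
Qed.

Lemma qpochoo3_coef0 : fcoef (qpochoo (q ^+ 3) (q ^+ 3)) 0 = 1.
Proof.
have [N0 H] := @qpoch_cvg _ (q ^+ 3) _ (fpsX_vanish1 (isT : 0 < 3)%N) 0%N.
rewrite -(H N0) // {H}.
elim: N0 => [|n IH]; first by rewrite qpoch0.
by rewrite qpochS fcoef0M IH -exprS -exprM fcoef0_1BXn.
Qed.

(** * Lambert series and divisor sums *)

Definition lambert n : fps int := FPS (fun m => if (n %| m)%N then (m %/ n)%N%:R else 0).

Lemma lambertE n : (0 < n)%N -> lambert n * (1 - q ^+ n) ^+ 2 = q ^+ n.
Proof.
move=> n0; rewrite expr2 mulrA.
(* One factor reduces the series to q^n / (1 - q^n), whose coefficients are 1 at positive multiples
   of n. *)
have -> : lambert n * (1 - q ^+ n) = FPS (fun m => ((n %| m) && (0 < m))%N%:R).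
  apply: fpsP => m; rewrite mulrBr mulr1 fcoefD fcoefN fcoefXM /=.
  case: (leqP n m) => [nm|mn].
    rewrite dvdn_subl ?dvdnn // (leq_trans n0 nm) andbT; case: ifP => // _.
    by rewrite -[in X in X - _](subnKC nm) divnDl ?dvdnn // divnn n0 natrD addrK.
  by rewrite subr0; case: m mn => [|m] mn; rewrite ?dvdn0 ?div0n // gtnNdvd.
apply: fpsP => m; rewrite mulrBr mulr1 fcoefD fcoefN fcoefXM /= fcoefXn.
case: (leqP n m) => [nm|mn]; last first.
  by rewrite subr0; case: m mn => [|m] mn; rewrite ?andbF ?gtnNdvd // ltn_eqF.
rewrite dvdn_subl ?dvdnn // (leq_trans n0 nm) andbT subn_gt0.
have [->|mn] := eqVneq m n; first by rewrite dvdnn ltnn subr0.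
by rewrite ltn_neqAle eq_sym mn nm !andbT subrr.
Qed.

(* Pair [d] with [m / d]: a product congruent to 2 modulo 3 has factors 1 and 2, whose *)
(* sum is divisible by 3. *)
Lemma dvd3_sum_divisors m N : (m < N)%N -> (m %% 3 = 2)%N ->
  (3 %| \sum_(d < N | d %| m) m %/ d)%N.
Proof.
move=> mN m2; have m0 : (0 < m)%N by case: m m2 {mN}.
case: N mN => // N mN.
have lt_d (d : nat) : (m %/ d < N.+1)%N by apply: leq_ltn_trans mN; apply: leq_div.
have E : (\sum_(d < N.+1 | d %| m) m %/ d = \sum_(d < N.+1 | d %| m) d)%N.
  rewrite [RHS](reindex_onto (fun d : 'I_N.+1 => inord (m %/ d))
    (fun d : 'I_N.+1 => inord (m %/ d))) /=; last first.
    by move=> d dm; apply/val_inj; rewrite /= !inordK // divnA // mulKn.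
  apply: eq_big => [d|d dm]; last by rewrite inordK.
  rewrite inordK //; apply/idP/andP => [dm|[mdm /eqP/(congr1 val) /=]].
    by split; [apply: dvdn_div | apply/eqP/val_inj; rewrite /= !inordK // divnA // mulKn].
  by rewrite !inordK // => <-; apply: dvdn_div.
(* As 2 is prime to 3, twice the sum may be treated: it is the sum of d + m/d. *)
rewrite -(@Gauss_dvdr 3 2) // mul2n -addnn {2}E -big_split /=.
apply: dvdn_sum => d /dvdnP[k mk]; move: m2; rewrite mk.
have d0 : (0 < d)%N by case: (d : nat) mk m0 => // ->; rewrite muln0.
rewrite mulnK // => e; rewrite /dvdn -modnDm; move: e; rewrite -modnMm.
have := ltn_pmod k (isT : 0 < 3)%N; have := ltn_pmod d (isT : 0 < 3)%N.
by case: (k %% 3)%N => [|[|[|]]] //; case: (d %% 3)%N => [|[|[|]]].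
Qed.

Lemma dvd3_upto_lambert N : dvd3_upto N.+1 (\sum_(n < N) lambert n.+1).
Proof.
move=> m mN m2.
have -> : fcoef (\sum_(n < N) lambert n.+1) m = (\sum_(d < N.+1 | d %| m) m %/ d)%N%:R.
  rewrite [in RHS]big_mkcond big_ord_recl /= natrD natr_sum.
  (* The index d = 0 contributes nothing, since division by 0 returns 0. *)
  have -> : (if (0 %| m)%N then (m %/ 0)%N else 0%N) = 0%N by rewrite divn0 if_same.
  rewrite add0r; elim/big_rec2: _ => // i x f _; rewrite fcoefD /= => ->.
  by case: ifP.
by have := dvd3_sum_divisors mN m2; set s := (\sum_(_ < _ | _) _)%N => s3; rewrite (natz s).
Qed.

(** * The terms with j > 0, and the congruence *)

Lemma dvdn3_bin2 k : (3 %| 'C(3 * k, 2))%N.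
Proof.
elim: k => // k IH; rewrite mulnS !binS !bin1 !bin0; move: IH; lia.
Qed.

(** Multiplied by (1 - q^j)^2, the sum becomes q^j + O(q^(N+1)) by [bailey_sum]; with 3 | j, the
    remaining factors are series in q^3. *)
Lemma dvd3_upto_bailey N r :
  dvd3_upto N.+1 ((1 + q ^+ (3 * r).+3) * jtp_sign (3 * r).+3 *
    \sum_(n < N) q ^+ n.+1 * P n ^+ 2 * bailey n.+1 (3 * r).+3).
Proof.
rewrite -[(3 * r).+3]/(3 + 3 * r)%N -mulnS.
have : (0 < 3 * r.+1)%N by [].
have : (3 %| 3 * r.+1)%N by apply: dvdn_mulr.
have : (3 %| 'C(3 * r.+1, 2))%N by apply: dvdn3_bin2.
move: (3 * r.+1)%N => j C3 j3 j0.
have q3 : series_in_q3 (q ^+ j) by apply: series_in_q3_Xn.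
have q3w : series_in_q3 ((1 + q ^+ j) * jtp_sign j).
  apply: series_in_q3M; first by apply: series_in_q3D => //; apply: series_in_q3_1.
  apply: series_in_q3M; last exact: series_in_q3_Xn.
  by apply/series_in_q3X/series_in_q3N/series_in_q3_1.
apply: (@dvd3_upto_cancel _ _ ((1 - q ^+ j) ^+ 2)).
- apply: series_in_q3X; apply: series_in_q3D; first exact: series_in_q3_1.
  exact: series_in_q3N.
- by rewrite expr2 fcoef0M fcoef0_1BXn.
rewrite -mulrA [X in _ * X]mulrC bailey_sum //.
apply: (@dvd3_upto_vanish _ _ ((1 + q ^+ j) * jtp_sign j * q ^+ j)).
  by rewrite -mulrBr; apply/fvanishMr/bailey_vanish.
by apply/dvd3_upto_q3/series_in_q3M.
Qed.

(** Insert [cubic_bailey] and exchange the sums, the range of r being the same for all n < N. The j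
    = 0 part gives the Lambert series because P (n+1) = P n (1 - q^(n+1)). *)
Lemma spt23_partial_sum N :
  (\sum_(1 <= n < N.+1) spt23_term n) * qpochoo (q ^+ 3) (q ^+ 3) =
  \sum_(n < N) lambert n.+1 +
    \sum_(r < N) (1 + q ^+ (3 * r).+3) * jtp_sign (3 * r).+3 *
      \sum_(n < N) q ^+ n.+1 * P n ^+ 2 * bailey n.+1 (3 * r).+3.
Proof.
rewrite big_add1 big_mkord mulr_suml.
under [X in _ = _ + X]eq_bigr => r _ do rewrite mulr_sumr.
rewrite exchange_big -big_split /=; apply: eq_bigr => -[n /= nN] _.
rewrite spt23_termE (cubic_bailey nN) mulrDr; congr (_ + _).
  rewrite (@bailey_ge n.+1 0 n.+1 n.+1) ?addn0 // -[X in X * _ * _](lambertE (ltn0Sn n)).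
  transitivity (lambert n.+1 * (P n.+1 / P n.+1) ^+ 2).
    by move: (P n.+1)^-1 => I; rewrite eulerS; ring.
  by rewrite mulrV ?unit_euler // expr1n mulr1.
by rewrite mulr_sumr; apply: eq_bigr => r _; ring.
Qed.

Theorem theorem5 (n : nat) : (3 %| spt23 (3 * n + 2))%Z.
Proof.
apply: (@dvd3_upto_cancel (3 * n + 2).+1 _ (qpochoo (q ^+ 3) (q ^+ 3))) => //.
- exact: qpochoo3_in_q3.
- exact: qpochoo3_coef0.
- move=> m mn m2.
  have [N0 H] := @fcvgMr _ _ (qpochoo (q ^+ 3) (q ^+ 3)) spt23_cvg m.
  (* [N0] stabilizes coefficient m, and the maximum with m keeps it within the range of the
     truncated congruences. *)
  rewrite -(H (maxn N0 m)) ?leq_maxl // spt23_partial_sum.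
  apply: (@dvd3_uptoD (maxn N0 m).+1) => //; first exact: dvd3_upto_lambert.
  + elim/big_rec: _ => [|r f _ IH]; first by move=> k _ _; rewrite dvdz0.
    exact/dvd3_uptoD/IH/dvd3_upto_bailey.
  + by rewrite ltnS leq_maxr.
- by rewrite mulnC modnMDl.
Qed.
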